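(* Assume the Continuum Hypothesis. Then there are spaces $X$ and $Y$ such that (1) for every cardinal $\lambda\ge 1$ (finite or infinite), the powers $X^{\lambda}$ and $Y^{\lambda}$ (with the product topology) are weakly Rothberger, and (2) $X\times Y$ is not weakly Menger.
   Context: All spaces are infinite ${\sf T}_1$ topological spaces. $\mathcal{O}$ denotes the collection of open covers of a space, and $\mathcal{D}$ denotes the collection of families $\mathcal{U}$ of open sets whose union $\bigcup\mathcal{U}$ is dense in the space. ${\sf S}_1(\mathcal{A},\mathcal{B})$: for each sequence $(A_n)$ of elements of $\mathcal{A}$ there are $B_n\in A_n$ with $\{B_n:n\in\mathbb{N}\}\in\mathcal{B}$. ${\sf S}_{fin}(\mathcal{A},\mathcal{B})$: for each sequence $(A_n)$ of elements of $\mathcal{A}$ there are finite $B_n\subseteq A_n$ with $\bigcup_n B_n\in\mathcal{B}$. A space is weakly Rothberger if it satisfies ${\sf S}_1(\mathcal{O},\mathcal{D})$, and weakly Menger if it satisfies ${\sf S}_{fin}(\mathcal{O},\mathcal{D})$. *)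

(* Defs.v *)
From Stdlib Require Import List.

Definition is_topology {T : Type} (op : (T -> Prop) -> Prop) : Prop :=
  op (fun _ => True) /\
  (forall U V, op U -> op V -> op (fun x => U x /\ V x)) /\
  (forall F : (T -> Prop) -> Prop, (forall U, F U -> op U) ->
     op (fun x => exists U, F U /\ U x)).

Definition T1_space {T : Type} (op : (T -> Prop) -> Prop) : Prop :=
  forall x y : T, x <> y -> exists U, op U /\ U x /\ ~ U y.

Definition infinite_type (T : Type) : Prop :=
  forall l : list T, exists x, ~ In x l.

Definition space {T : Type} (op : (T -> Prop) -> Prop) : Prop :=
  is_topology op /\ T1_space op /\ infinite_type T.

Definition open_cover {T : Type} (op : (T -> Prop) -> Prop)
  (C : (T -> Prop) -> Prop) : Prop :=
  (forall U, C U -> op U) /\ (forall x, exists U, C U /\ U x).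

Definition dense {T : Type} (op : (T -> Prop) -> Prop) (D : T -> Prop) : Prop :=
  forall V, op V -> (exists x, V x) -> exists x, V x /\ D x.

Definition weakly_Rothberger {T : Type} (op : (T -> Prop) -> Prop) : Prop :=
  forall C : nat -> (T -> Prop) -> Prop,
    (forall n, open_cover op (C n)) ->
    exists B : nat -> (T -> Prop),
      (forall n, C n (B n)) /\
      dense op (fun x => exists n, B n x).

Definition weakly_Menger {T : Type} (op : (T -> Prop) -> Prop) : Prop :=
  forall C : nat -> (T -> Prop) -> Prop,
    (forall n, open_cover op (C n)) ->
    exists B : nat -> list (T -> Prop),
      (forall n U, In U (B n) -> C n U) /\
      dense op (fun x => exists n U, In U (B n) /\ U x).

Definition prod_open {X Y : Type} (oX : (X -> Prop) -> Prop)
  (oY : (Y -> Prop) -> Prop) (W : X * Y -> Prop) : Prop :=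
  forall p, W p -> exists U V, oX U /\ oY V /\ U (fst p) /\ V (snd p) /\
    (forall q, U (fst q) -> V (snd q) -> W q).

Definition power_open {X : Type} (I : Type) (oX : (X -> Prop) -> Prop)
  (W : (I -> X) -> Prop) : Prop :=
  forall f, W f -> exists (l : list I) (V : I -> X -> Prop),
    (forall i, oX (V i)) /\ (forall i, In i l -> V i (f i)) /\
    (forall g, (forall i, In i l -> V i (g i)) -> W g).

Definition CH : Prop :=
  forall A : (nat -> bool) -> Prop,
    (exists f : nat -> (nat -> bool), forall x, A x -> exists n, f n = x) \/
    (exists g : (nat -> bool) -> (nat -> bool),
        (forall y, A (g y)) /\ (forall y z, g y = g z -> y = z)).

(* Main.v *)
(* Under CH the reals A carry a well-order with countable initial segments, along
   which one chooses unbounded functions h_a : nat -> nat. Both spaces have points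
   nat + A with A isolated; basic neighbourhoods of an integer are
     {m} + {a : N <= h_a(m)}                    in X,
     {k} + {a : h_a(n) <= k for all n < N}      in Y.
   The neighbourhoods with N = k+1 in X and N = m+1 in Y share no a, so the diagonal
   of A is an uncountable closed discrete set of isolated points of X x Y, and X x Y
   is not even weakly Lindelof. Each h_a is chosen generically over the countably
   many functions obtained from its predecessors, so that for all M of finitely many
   integer variables and all large enough a_1 < ... < a_n there are m_1, ..., m_n such
   that each a_i lies in the neighbourhood of m_i of index M(m_1, ..., m_n). In a power
   of X or Y, choose members of the covers around the points with finitely many
   non-zero coordinates, in a countable set of coordinates and values that is closed
   under this choice; by genericity the union meets every basic open set. *)
From mathcomp Require Import all_boot.
From mathcomp Require Import boolp wochoice zify.
From Stdlib Require Import Wellfounded.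
Require Import Defs.

Set Implicit Arguments.
Unset Strict Implicit.
Unset Printing Implicit Defensive.

(** * Countability and a well-order from CH *)

Definition enumerable (T : Type) (P : T -> Prop) : Prop :=
  exists f : nat -> T, forall x, P x -> exists n, f n = x.

Lemma enumerable_preimage (T U : Type) (g : T -> U) (P : U -> Prop) :
  inhabited T -> injective g -> enumerable P -> enumerable (fun x => P (g x)).
Proof.
move=> [t0] g_inj [f f_onto].
have /choice[e e_spec] (n : nat) : exists x, forall y, f n = g y -> x = y.
  have [[y fy]|no_y] := pselect (exists y, f n = g y).
    by exists y => z; rewrite fy => /g_inj.
  by exists t0 => y fy; case: no_y; exists y.
by exists e => x /f_onto[n /e_spec <-]; exists n.
Qed.

Lemma not_enumerable_cantor : ~ enumerable (fun _ : nat -> bool => True).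
Proof.
case=> f /(_ (fun n => ~~ f n n) I)[n fn].
by have := congr1 (@^~ n) fn => /=; case: (f n n).
Qed.

(** If a well-order has an uncountable initial segment, take the least [b] with one: CH injects
    [nat -> bool] into the segment below [b], and the order pulled back along this injection has
    countable segments. *)
Lemma CH_well_order : CH ->
  exists lt : (nat -> bool) -> (nat -> bool) -> Prop,
    [/\ well_founded lt, forall a b c, lt a b -> lt b c -> lt a c,
        forall a b, [\/ lt a b, a = b | lt b a] &
        forall b, enumerable (lt^~ b)].
Proof.
move=> ch; have [R0 R0wo] := well_ordering_principle {classic nat -> bool}.
pose R (a b : nat -> bool) : Prop := R0 a b.
have R_min (P : (nat -> bool) -> Prop) :
    (exists x, P x) -> exists z, P z /\ forall x, P x -> R z x.
  case=> x Px; have [|z [[Pz minz] _]] := R0wo (fun y => `[< P y >]).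
    by exists x; apply/asboolP.
  by exists z; split=> [|y Py]; [apply/asboolP | apply: minz; apply/asboolP].
have R_anti a b : R a b -> R b a -> a = b.
  move=> Rab Rba; apply: (@wo_chain_antisymmetric _ R0 predT) => //.
    exact: withinW.
  by rewrite [R0 a b]Rab.
have R_total a b : R a b \/ R b a.
  have [|z [[->|->] minz]] := R_min (fun x => x = a \/ x = b).
  - by exists a; left.
  - by left; apply: minz; right.
  - by right; apply: minz; left.
have R_trans a b c : R a b -> R b c -> R a c.
  move=> Rab Rbc.
  have [|z [z_abc minz]] := R_min (fun x => [\/ x = a, x = b | x = c]).
    by exists a; constructor 1.
  case: z_abc => zE; subst z; first by apply: minz; constructor 3.
  - by rewrite (R_anti a b) //; apply: minz; constructor 1.
  - by rewrite (R_anti c b) //; apply: minz; constructor 2.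
pose lt0 a b := ~ R b a.
have lt0_wf : well_founded lt0.
  move=> a; apply: contrapT => nAcc.
  have [|z [nAccz minz]] := R_min (fun x => ~ Acc lt0 x); first by exists a.
  apply: nAccz; constructor=> y lt_yz; apply: contrapT => /minz; exact: lt_yz.
have lt0_trans a b c : lt0 a b -> lt0 b c -> lt0 a c.
  move=> ab bc Rca; apply: bc; apply: R_trans Rca _.
  by case: (R_total a b) => // /ab.
have lt0_tri a b : [\/ lt0 a b, a = b | lt0 b a].
  have [Rba|] := pselect (R b a); last by constructor 1.
  have [Rab|] := pselect (R a b); last by constructor 3.
  by constructor 2; apply: R_anti.
suff [g [g_inj g_enum]] : exists g : (nat -> bool) -> (nat -> bool),
    injective g /\ forall b, enumerable (lt0^~ (g b)).
  exists (fun a b => lt0 (g a) (g b)); split.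
  - exact: wf_inverse_image.
  - by move=> a b c; apply: lt0_trans.
  - move=> a b; case: (lt0_tri (g a) (g b)) => [?|/g_inj|?].
    + by constructor 1.
    + by constructor 2.
    + by constructor 3.
  - move=> b; apply: enumerable_preimage g_inj (g_enum b).
    exact: (inhabits b).
have [seg|] := pselect (forall b, enumerable (lt0^~ b)).
  by exists id; split.
move/existsNP/R_min=> [b [b_big minb]].
have [[f f_onto]|[g [g_lt g_inj]]] := ch (lt0^~ b); first by case: b_big; exists f.
exists g; split=> // a; apply: contrapT => /minb; exact: g_lt.
Qed.

(** * Transfinite recursion and diagonalization *)

(** Since [P a] only looks at [h] below [a], the recursion may extend partial functions by the
    default [b0]. *)
Lemma well_founded_choice (A B : Type) (lt : A -> A -> Prop)
    (P : A -> (A -> B) -> B -> Prop) :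
  inhabited B -> well_founded lt -> (forall a h, exists b, P a h b) ->
  (forall a h h' b, (forall c, lt c a -> h c = h' c) -> P a h b -> P a h' b) ->
  exists h, forall a, P a h (h a).
Proof.
move=> [b0] lt_wf exP locP.
pose ext a (f : forall c, lt c a -> B) c :=
  if pselect (lt c a) is left p then f c p else b0.
pose sel a h := sval (cid (exP a h)).
pose F a f := sel a (ext a f).
pose h := Fix lt_wf (fun _ => B) F.
have hE a : h a = F a (fun c _ => h c).
  rewrite /h Fix_eq // => x f g fg; congr (sel x _).
  by apply/funext => c; rewrite /ext; case: pselect.
exists h => a; rewrite [in X in P _ _ X]hE /F /sel; case: cid => b Pb /=.
by apply: locP Pb => c ca; rewrite /ext; case: pselect.
Qed.

(* The diagonalization: [h] reaches [phi i] somewhere, while also staying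
   below some [k] on the initial segment of length [phi i k]. *)
Lemma escaping_function (phi : nat -> nat -> nat) : exists h : nat -> nat,
  [/\ forall k, exists m, k < h m, forall i, exists m, phi i m <= h m &
      forall i, exists k, forall m, m < phi i k -> h m <= k].
Proof.
pose step i (p : nat * nat) :=
  let m := (p.1 + phi i p.2).+1 in (m, (p.2 + phi i.+1 m).+1).
pose st := fix st i := if i is j.+1 then step j (st j) else (0, phi 0 0).
pose m i := (st i).1; pose k i := (st i).2.
have mS i : m i.+1 = (m i + phi i (k i)).+1 by [].
have kS i : k i.+1 = (k i + phi i.+1 (m i.+1)).+1 by [].
have m_mono : {homo m : i j / i <= j}.
  by apply: homo_leq => // [? ? ?|i]; [apply: leq_trans | rewrite mS; lia].
have k_mono : {homo k : i j / i <= j}.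
  by apply: homo_leq => // [? ? ?|i]; [apply: leq_trans | rewrite kS; lia].
have le_m i : i <= m i by elim: i => // i IH; rewrite mS; lia.
have le_k i : i <= k i by elim: i => // i IH; rewrite kS; lia.
(* [h] jumps to [k i] at [m i], where [phi i (m i) <= k i], and stays there until [m i.+1], which
   exceeds [phi i (k i)]. *)
pose h n := \max_(i < n.+1 | m i <= n) k i.
have h_ge i : k i <= h (m i).
  have lt_i : i < (m i).+1 by rewrite ltnS.
  exact: (@leq_bigmax_cond _ (fun j : 'I__ => m j <= m i)
    (fun j : 'I__ => k j) (Ordinal lt_i)).
exists h; split.
- by move=> n; exists (m n.+1); apply: leq_trans (h_ge _).
- move=> i; exists (m i); apply: leq_trans (h_ge _).
  by case: i => // i; rewrite kS; lia.
- move=> i; exists (k i) => n lt_n; apply/bigmax_leqP => j le_mj.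
  apply: k_mono; rewrite leqNgt; apply/negP => /m_mono; rewrite mS; lia.
Qed.

(** * Generic families of functions *)

Definition upper_rel (f : nat -> nat) (m N : nat) : Prop := N <= f m.

Definition lower_rel (f : nat -> nat) (k N : nat) : Prop :=
  forall n, n < N -> f n <= k.

Definition pick_nat (P : nat -> Prop) : nat :=
  if pselect (exists m, P m) is left e then sval (cid e) else 0.

Lemma pick_natP (P : nat -> Prop) : (exists m, P m) -> P (pick_nat P).
Proof. by rewrite /pick_nat; case: pselect => // e _; case: cid. Qed.

(* Fixes the first argument [m] of [M] as a function of the others so that
   [Q m] holds at the resulting value. *)
Definition absorb (Q : nat -> nat -> Prop) (M : seq nat -> nat) (s : seq nat) :=
  M (pick_nat (fun m => Q m (M (m :: s))) :: s).

(** The countably many functions over which the choice at [b] has to be generic. *)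
Inductive reachable (A : Type) (lt : A -> A -> Prop) (E : A -> seq nat -> nat)
    (Q : A -> nat -> nat -> Prop) (b : A) : (seq nat -> nat) -> Prop :=
| reachable_base a : lt a b -> reachable lt E Q b (E a)
| reachable_absorb a M : lt a b -> reachable lt E Q b M ->
    reachable lt E Q b (absorb (Q a) M).

Lemma eq_reachable (A : Type) (lt : A -> A -> Prop) E Q Q' b M :
  (forall a, lt a b -> Q a = Q' a) ->
  reachable lt E Q b M -> reachable lt E Q' b M.
Proof.
move=> QQ'; elim=> [a ab|a {}M ab _ IH]; first exact: reachable_base.
by rewrite (QQ' a ab); apply: reachable_absorb.
Qed.

Lemma enumerable_reachable (A : Type) (lt : A -> A -> Prop) E Q b :
  enumerable (lt^~ b) -> enumerable (reachable lt E Q b).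
Proof.
case=> e e_onto.
pose val (p : nat * seq nat) := foldr (fun i => absorb (Q (e i))) (E (e p.1)) p.2.
exists (fun n => val (odflt (0, [::]) (unpickle n))).
suff val_onto M : reachable lt E Q b M -> exists p, val p = M.
  by move=> M /val_onto[p <-]; exists (pickle p); rewrite pickleK.
elim=> [_ /e_onto[i <-]|_ {}M /e_onto[i <-] _ [[j l] <-]].
  by exists (i, [::]).
by exists (j, i :: l).
Qed.

Fixpoint increasing (A : Type) (lt : A -> A -> Prop) (l : seq A) : Prop :=
  if l is a :: r then (forall b, List.In b r -> lt a b) /\ increasing lt r
  else True.

(** The threshold [c] depends on [M] alone, not on the length of [l]. *)
Definition catching (A : Type) (lt : A -> A -> Prop)
    (Q : A -> nat -> nat -> Prop) : Prop :=
  forall M : seq nat -> nat, exists c, forall l, increasing lt l ->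
    (forall a, List.In a l -> lt c a) ->
    exists ms, forall i a, onth l i = Some a -> Q a (nth 0 ms i) (M ms).

(** The integer for the least element [a] is chosen last, as a function of the others; absorbing it
    leaves a function reachable at every later element, so induction applies to the tail. *)
Lemma catching_reachable (A : Type) (lt : A -> A -> Prop) E Q :
  (forall a b c, lt a b -> lt b c -> lt a c) -> (forall M, exists a, E a = M) ->
  (forall b M s, reachable lt E Q b M -> exists m, Q b m (M (m :: s))) ->
  catching lt Q.
Proof.
move=> tr E_onto gen M; have [c cM] := E_onto M; exists c => l l_inc l_gt.
have {l_gt} : forall a, List.In a l -> reachable lt E Q a M.
  by move=> a /l_gt ca; rewrite -cM; apply: reachable_base.
elim: l M l_inc {c cM} => [|a l IH] M /=.
  by move=> _ _; exists [::] => -[].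
case=> lt_a l_inc reach.
have [b lb|ms msP] := IH (absorb (Q a) M) l_inc.
  by apply: reachable_absorb; [apply: lt_a | apply: reach; right].
exists (pick_nat (fun m => Q a m (M (m :: ms))) :: ms) => -[|i] b /=.
  case=> <-; apply: (@pick_natP (fun m => Q a m (M (m :: ms)))); apply: gen.
  by apply: reach; left.
exact: msP.
Qed.

Lemma catching_family (A : Type) (lt : A -> A -> Prop) (E : A -> seq nat -> nat) :
  well_founded lt -> (forall a b c, lt a b -> lt b c -> lt a c) ->
  (forall b, enumerable (lt^~ b)) -> (forall M, exists a, E a = M) ->
  exists h : A -> nat -> nat,
    [/\ forall a k, exists m, k < h a m,
        catching lt (fun a => upper_rel (h a)) &
        catching lt (fun a => lower_rel (h a))].
Proof.
move=> wf tr seg E_onto.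
pose meets rel (b : A) (h : A -> nat -> nat) (f : nat -> nat) := forall M s,
  reachable lt E (fun a => rel (h a)) b M -> exists m : nat, rel f m (M (m :: s)).
have [] := @well_founded_choice A (nat -> nat) lt (fun b h f =>
    [/\ forall k, exists m, k < f m, meets upper_rel b h f & meets lower_rel b h f]).
- exact: (inhabits id).
- exact: wf.
- move=> b h.
  have [e1 e1_onto] := enumerable_reachable E (fun a => upper_rel (h a)) (seg b).
  have [e2 e2_onto] := enumerable_reachable E (fun a => lower_rel (h a)) (seg b).
  (* Fixing the parameters [s] gives countably many one-variable functions; the boolean selects the
     relation being treated. *)
  pose task (p : bool * nat * seq nat) m :=
    (if p.1.1 then e1 else e2) p.1.2 (m :: p.2).
  have [f [f_unb f_up f_low]] :=
    escaping_function (fun i => task (odflt (true, 0, [::]) (unpickle i))).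
  exists f; split=> // M s.
  + move=> /e1_onto[n <-]; have [m] := f_up (pickle (true, n, s)).
    by rewrite pickleK; exists m.
  + move=> /e2_onto[n <-]; have [m] := f_low (pickle (false, n, s)).
    by rewrite pickleK; exists m.
- move=> b h h' f hh' [f_unb f_up f_low]; split=> // M s reach.
  + by apply: f_up; apply: eq_reachable reach => a /hh' ->.
  + by apply: f_low; apply: eq_reachable reach => a /hh' ->.
- move=> h hP; exists h; split=> [a||].
  + by case: (hP a).
  + by apply: catching_reachable => // b M s; case: (hP b) => _ + _; apply.
  + by apply: catching_reachable => // b M s; case: (hP b) => _ _; apply.
Qed.

(** * Finite lists *)

Lemma increasing_rearrangement (A : Type) (lt : A -> A -> Prop) (l : seq A) :
  (forall a b c, lt a b -> lt b c -> lt a c) ->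
  (forall a b, [\/ lt a b, a = b | lt b a]) ->
  exists l', increasing lt l' /\ forall a, List.In a l' <-> List.In a l.
Proof.
move=> tr tri; elim: l => [|a l [l' [l'_inc l'E]]]; first by exists [::].
suff [r [r_inc rE]] : exists r, increasing lt r /\
    forall b, List.In b r <-> a = b \/ List.In b l'.
  by exists r; split=> // b; rewrite rE l'E.
elim: l' l'_inc {l'E} => [|b r IH] /=; first by exists [:: a].
case=> lt_b r_inc; have [ab|->|ba] := tri a b.
- exists [:: a, b & r]; split=> //=; split=> // c [<-//|/lt_b].
  exact: tr.
- by exists (b :: r); split=> // c /=; tauto.
- have [r' [r'_inc r'E]] := IH r_inc; exists (b :: r'); split=> /=.
    by split=> // c /r'E[<-//|/lt_b].
  by move=> c; rewrite r'E; tauto.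
Qed.

Lemma In_onth (A : Type) (l : seq A) a : List.In a l -> exists i, onth l i = Some a.
Proof.
elim: l => //= b l IH [->|/IH[i]]; first by exists 0.
by exists i.+1.
Qed.

Lemma In_pmap (T U : Type) (f : T -> option U) (l : seq T) u :
  List.In u (pmap f l) <-> exists2 i, List.In i l & f i = Some u.
Proof.
elim: l => [|i l IH] /=; first by split=> // -[].
case fi: (f i) => [w|] /=; rewrite IH; split.
- by case=> [<-|[j lj fj]]; [exists i; [left|] | exists j; [right|]].
- by case=> j [<-|lj] fj; [left; move: fj; rewrite fi => -[] | right; exists j].
- by case=> j lj fj; exists j; [right|].
- by case=> j [<-|lj] fj; [move: fj; rewrite fi | exists j].
Qed.

(** * The topology on [nat + A] *)

(* The space on [nat + A] given by [Q]: each [inr a] is isolated, and [inl m] has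
   the basic neighbourhoods {inl m} + {inr a : Q a m N}, for N in nat. *)
Definition nbhd (A : Type) (Q : A -> nat -> nat -> Prop) (x : nat + A) (N : nat)
    (y : nat + A) : Prop :=
  y = x \/ match x, y with inl m, inr a => Q a m N | _, _ => False end.

Definition nbhd_open (A : Type) (Q : A -> nat -> nat -> Prop)
    (U : nat + A -> Prop) : Prop :=
  forall x, U x -> exists N, forall y, nbhd Q x N y -> U y.

Definition antitone_rel (A : Type) (Q : A -> nat -> nat -> Prop) : Prop :=
  forall a m N N', N <= N' -> Q a m N' -> Q a m N.

Lemma nbhdW (A : Type) (Q : A -> nat -> nat -> Prop) x N N' y :
  antitone_rel Q -> N <= N' -> nbhd Q x N' y -> nbhd Q x N y.
Proof.
move=> Qanti NN' [->|]; first by left.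
by case: x y => [m|a] [n|b] //= Qb; right; apply: Qanti Qb.
Qed.

Lemma nbhd_open_nbhd (A : Type) (Q : A -> nat -> nat -> Prop) x N :
  nbhd_open Q (nbhd Q x N).
Proof.
move=> y [->|]; first by exists N.
by case: x y => [m|a] [n|b] //= Qb; exists 0 => z [->|//]; right.
Qed.

Lemma nbhd_open_neq (A : Type) (Q : A -> nat -> nat -> Prop) x :
  (forall a m, exists N, ~ Q a m N) -> nbhd_open Q (fun y => y <> x).
Proof.
move=> Qsep [m|a] neq; last by exists 0 => y [->|].
case: x neq => [n|b] neq; first by exists 0 => -[k|b] [->|//].
by have [N nQ] := Qsep b m; exists N => y [->//|] Qb yb; subst y.
Qed.

Lemma nbhd_space (A : Type) (Q : A -> nat -> nat -> Prop) :
  antitone_rel Q -> (forall a m, exists N, ~ Q a m N) -> space (nbhd_open Q).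
Proof.
move=> Qanti Qsep; split; [split; [|split]|split].
- by move=> x _; exists 0.
- move=> U V Uo Vo x [/Uo[N UN] /Vo[N' VN']]; exists (maxn N N') => y yN.
  split; [apply: UN|apply: VN']; apply: nbhdW yN => //.
    exact: leq_maxl.
  exact: leq_maxr.
- move=> F Fo x [U [FU Ux]]; have [N UN] := Fo U FU x Ux.
  by exists N => y /UN Uy; exists U.
- move=> x y xy; exists (fun z => z <> y); split; first exact: nbhd_open_neq.
  by split=> // /(_ erefl).
- move=> l; exists (inl (\sum_(x <- l) if x is inl n then n.+1 else 0)).
  suff lt_sum n : List.In (inl n) l ->
      n < \sum_(x <- l) if x is inl n then n.+1 else 0.
    by move=> /lt_sum; rewrite ltnn.
  elim: l => //= x l IH; rewrite big_cons => -[->|/IH]; first exact: leq_addr.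
  by move=> lt_n; apply: leq_trans (leq_addl _ _).
Qed.

(** * Powers are weakly Rothberger *)

(* A cover of [(nat + A) ^ I] is handled through finite patterns: lists of pairs
   [(i, v)] giving coordinate [i] either a point [v = inl x] or the variable
   [v = inr j], which is to be instantiated by the integer [nth 0 s j]. *)
Fixpoint instance (I A : Type) (q : seq (I * ((nat + A) + nat))) (s : seq nat)
    (i : I) : nat + A :=
  if q is (j, v) :: r then
    if pselect (i = j) then
      match v with inl x => x | inr k => inl (nth 0 s k) end
    else instance r s i
  else inl 0.

Lemma instance_graph (I A : Type) (v : I -> (nat + A) + nat) l s i :
  List.In i l ->
  instance [seq (j, v j) | j <- l] s i =
    match v i with inl x => x | inr k => inl (nth 0 s k) end.
Proof.
elim: l => //= j l IH; case: pselect => [ij _|ne [ji|/IH//]].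
  by rewrite /= ij.
by case: ne.
Qed.

(** Codes evaluate to single coordinates or values, so a pattern is stored as an alternating list;
    an ill-formed list is truncated. *)
Fixpoint parse (I V : Type) (l : seq (I + V)) : seq (I * V) :=
  if l is inl i :: inr v :: r then (i, v) :: parse r else [::].

Fixpoint flat (I V : Type) (q : seq (I * V)) : seq (I + V) :=
  if q is (i, v) :: r then inl i :: inr v :: flat r else [::].

Lemma flatK (I V : Type) : cancel (@flat I V) (@parse I V).
Proof. by elim=> //= -[i v] q /= ->. Qed.

Lemma In_flat (I V : Type) (f : I -> V) (u : I + V) l :
  List.In u (flat [seq (i, f i) | i <- l]) ->
  exists2 i, List.In i l & u = inl i \/ u = inr (f i).
Proof.
elim: l => //= j l IH [<-|[<-|/IH[i li uE]]].
- by exists j; [left|left].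
- by exists j; [left|right].
- by exists i; [right|].
Qed.

Lemma power_open_nbhd (A I : Type) (Q : A -> nat -> nat -> Prop)
    (W : (I -> nat + A) -> Prop) f :
  antitone_rel Q -> power_open I (nbhd_open Q) W -> W f ->
  exists (l : seq I) N, forall g,
    (forall i, List.In i l -> nbhd Q (f i) N (g i)) -> W g.
Proof.
move=> Qanti Wo /Wo[l [V [Vo [Vf VW]]]]; exists l.
suff [N VN] : exists N, forall i y, List.In i l -> nbhd Q (f i) N y -> V i y.
  by exists N => g gN; apply: VW => i li; apply: VN => //; apply: gN.
elim: l Vf {VW} => [|i l IH] Vf; first by exists 0.
have [|N VN] := IH; first by move=> j lj; apply: Vf; right.
have [N' VN'] := Vo i (f i) (Vf i (or_introl erefl)).
exists (maxn N N') => j y [<-|lj] yN.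
- by apply: VN'; apply: nbhdW yN => //; apply: leq_maxr.
- by apply: VN => //; apply: nbhdW yN => //; apply: leq_maxl.
Qed.

Lemma power_weakly_Rothberger (A I : Type) (lt : A -> A -> Prop)
    (Q : A -> nat -> nat -> Prop) :
  inhabited A -> inhabited I ->
  (forall a b c, lt a b -> lt b c -> lt a c) ->
  (forall a b, [\/ lt a b, a = b | lt b a]) ->
  (forall b, enumerable (lt^~ b)) ->
  antitone_rel Q -> catching lt Q ->
  weakly_Rothberger (power_open I (nbhd_open Q)).
Proof.
move=> [a0] [i0] tr tri seg Qanti catch C Ccov.
(* By totality these are [c] and its predecessors, hence countably many. *)
have /choice[below belowP] c : exists e : nat -> A,
    forall a, ~ lt c a -> exists n, e n = a.
  have [e e_onto] := seg c; exists (fun n => if n is m.+1 then e m else c) => a.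
  case: (tri a c) => // [/e_onto[n <-] _|-> _]; [by exists n.+1 | by exists 0].
have /choice[bnd bndP] := catch.
have sel_ex (nf : nat * (I -> nat + A)) :
    exists BlN : ((I -> nat + A) -> Prop) * seq I * nat,
    C nf.1 BlN.1.1 /\ forall g,
      (forall i, List.In i BlN.1.2 -> nbhd Q (nf.2 i) BlN.2 (g i)) -> BlN.1.1 g.
  case: nf => n f /=; have [Cop /(_ f)[B [CB Bf]]] := Ccov n.
  by have [l [N BlN]] := power_open_nbhd Qanti (Cop B CB) Bf; exists (B, l, N).
have {sel_ex}/choice[sel selP] := sel_ex.
pose pattern := seq (I * ((nat + A) + nat)).
(* [eval] names, by countably many codes, enough coordinates and values for the
   supports and the bounds of all the patterns it names to be named as well. The
   [n]-th cover is used for the pattern and the instance coded by [n]. *)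
pose code := GenTree.tree (nat + nat).
pose index (ts : seq code) (s : seq nat) := pickle (ts, s).
pose chosen (q : pattern) ts s := sel (index ts s, instance q s).
pose bound q ts s := (chosen q ts s).2.
pose eval := fix eval (t : code) : I + ((nat + A) + nat) :=
  match t with
  | GenTree.Leaf (inl n) => inr (inl (inl n))
  | GenTree.Leaf (inr j) => inr (inr j)
  | GenTree.Node k ts =>
      let q := parse (map eval ts) in
      match unpickle k with
      | Some (inl (s, j)) => inl (nth i0 (chosen q ts s).1.2 j)
      | Some (inr j) => inr (inl (inr (below (bnd (bound q ts)) j)))
      | None => inl i0
      end
  end.
pose point (n : nat) : I -> nat + A :=
  if unpickle n is Some (ts, s) then instance (parse (map eval ts)) s
  else fun=> inl 0.
exists (fun n => (sel (n, point n)).1.1); split.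
  by move=> n; case: (selP (n, point n)).
move=> V Vop [f Vf].
have [l [N Vl]] := power_open_nbhd Qanti Vop Vf.
pose named u := exists t, eval t = u.
pose fresh (a : A) := ~ named (inr (inl (inr a))).
pose freshs := pmap (fun i => if f i is inr a then
  if pselect (fresh a) then Some a else None else None) l.
have freshsP a : List.In a freshs -> fresh a.
  by case/In_pmap=> i _; case: (f i) => // b; case: pselect => // fr [<-].
have In_freshs i a : List.In i l -> f i = inr a -> fresh a -> List.In a freshs.
  by move=> li fia fr; apply/In_pmap; exists i => //; rewrite fia; case: pselect.
have [bs [bs_inc bsE]] := increasing_rearrangement freshs tr tri.
(* [v] is [f] on [l], with the [j]-th fresh value replaced by the variable [j]. *)
have /choice[v vP] i : exists v : (nat + A) + nat, List.In i l ->
    named (inr v) /\ match v with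
      | inl x => f i = x
      | inr j => exists2 a, f i = inr a & onth bs j = Some a
      end.
  have [li|] := pselect (List.In i l); last by exists (inr 0).
  case fi: (f i) => [n|a].
    by exists (inl (inl n)) => _; split=> //; exists (GenTree.Leaf (inl n)).
  have [fr|/contrapT nm] := pselect (fresh a); last by exists (inl (inr a)).
  have [j bsj] : exists j, onth bs j = Some a.
    by apply: In_onth; apply/bsE; apply: (In_freshs i).
  exists (inr j) => _; split; last by exists a.
  by exists (GenTree.Leaf (inr j)).
pose kept := pmap (fun i => if pselect (named (inl i)) then Some i else None) l.
have In_kept i : List.In i kept <-> List.In i l /\ named (inl i).
  split=> [/In_pmap[j lj]|[li nm]]; first by case: pselect => // nm [<-].
  by apply/In_pmap; exists i => //; case: pselect.
pose q := [seq (i, v i) | i <- kept].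
have [ts tsE] : exists ts, map eval ts = flat q.
  suff : forall u, List.In u (flat q) -> named u.
    elim: (flat q) => [|u r IH] r_named; first by exists [::].
    have [t <-] := r_named u (or_introl erefl).
    have [|ts <-] := IH; first by move=> u' ?; apply: r_named; right.
    by exists (t :: ts).
  move=> u /In_flat[i /In_kept[li i_named]] [->//|->].
  by case: (vP i li).
(* Nodes over [ts] name everything not above the threshold of [bound q ts], so the fresh values lie
   above it. *)
have [|ms msP] := bndP (bound q ts) bs bs_inc.
  move=> a /bsE/freshsP fr; apply: contrapT => /belowP[j ja]; apply: fr.
  exists (GenTree.Node (pickle (inr j : (seq nat * nat) + nat)) ts) => /=.
  by rewrite pickleK -/eval tsE flatK ja.
have point_index : point (index ts ms) = instance q ms.
  by rewrite /point pickleK tsE flatK.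
(* [g] follows [f] on [l] to stay in [V], and the instance elsewhere to enter the chosen member. *)
pose g i := if pselect (List.In i l) then f i else instance q ms i.
exists g; split.
  by apply: Vl => i li; left; rewrite /g; case: pselect.
exists (index ts ms); rewrite point_index.
have [_ sub_sel] := selP (index ts ms, instance q ms); apply: sub_sel => i /= i_supp.
rewrite /g; case: pselect => [li|nli] /=; last by left.
have i_named : named (inl i).
  have [j ij] := In_onth i_supp.
  exists (GenTree.Node (pickle (inl (ms, j) : (seq nat * nat) + nat)) ts) => /=.
  rewrite pickleK -/eval tsE flatK; congr inl.
  exact: onth_nth ij.
rewrite instance_graph; last by apply/In_kept.
have [_] := vP i li; case: (v i) => [x ->|j [a -> bsj]]; first by left.
by right; apply: msP bsj.
Qed.

(** * The product is not weakly Menger *)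

(** The open sets with at most one diagonal point [diag a] form a cover. These points are isolated,
    so a dense union contains them all, and countably many such sets would enumerate [A]. *)
Lemma product_not_weakly_Menger (A : Type) (Q Q' : A -> nat -> nat -> Prop) :
  ~ enumerable (fun _ : A => True) -> inhabited A ->
  (forall m k, exists N N', forall a, Q a m N -> ~ Q' a k N') ->
  ~ weakly_Menger (prod_open (nbhd_open Q) (nbhd_open Q')).
Proof.
move=> A_unc [a0] disj wM; apply: A_unc.
pose XY := ((nat + A) * (nat + A))%type.
pose diag a : XY := (inr a, inr a).
have isolated (R : A -> nat -> nat -> Prop) a : nbhd_open R (eq^~ (inr a)).
  by move=> _ ->; exists 0 => y [].
have full_open (R : A -> nat -> nat -> Prop) : nbhd_open R (fun=> True).
  by move=> x _; exists 0.
pose C (W : XY -> Prop) := prod_open (nbhd_open Q) (nbhd_open Q') W /\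
  forall a b, W (diag a) -> W (diag b) -> a = b.
have box_open U V : nbhd_open Q U -> nbhd_open Q' V ->
    prod_open (nbhd_open Q) (nbhd_open Q') (fun p => U p.1 /\ V p.2).
  by move=> Uo Vo p [Up Vp]; exists U, V; do !split.
have [|B [BC B_dense]] := wM (fun=> C).
  move=> _; split=> [U []//|[x y]].
  case: x => [m|a]; last first.
    exists (fun p => p.1 = inr a /\ True); split=> //; split.
      exact: (box_open _ _ (isolated Q a) (full_open Q')).
    by move=> b c [[->] _] [[->] _].
  case: y => [k|a]; last first.
    exists (fun p => True /\ p.2 = inr a); split=> //; split.
      exact: (box_open _ _ (full_open Q) (isolated Q' a)).
    by move=> b c [_ [->]] [_ [->]].
  have [N [N' NN']] := disj m k.
  exists (fun p => nbhd Q (inl m) N p.1 /\ nbhd Q' (inl k) N' p.2).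
  split; last by split; left.
  split; first by apply: box_open; apply: nbhd_open_nbhd.
  by move=> a b [[//|Qa] [//|Q'a]]; case: (NN' a).
have covered a : exists n i, exists2 U, onth (B n) i = Some U & U (diag a).
  have [||p [[p1 p2] [n [U [BU Up]]]]] :=
      B_dense (fun p => p.1 = inr a /\ p.2 = inr a).
  - exact: (box_open _ _ (isolated Q a) (isolated Q' a)).
  - by exists (diag a).
  - have [i BUi] := In_onth BU; exists n, i, U => //; move: p1 p2 Up.
    by case: p => x y /= -> ->.
have /choice[e eP] (p : nat * nat) : exists a, forall U b,
    onth (B p.1) p.2 = Some U -> U (diag b) -> a = b.
  case BU: (onth (B p.1) p.2) => [U|]; last by exists a0.
  have [[a Ua]|no_a] := pselect (exists a, U (diag a)); last first.
    by exists a0 => V b [<-] Ub; case: no_a; exists b.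
  exists a => V b [<-] Ub; have /BC[_] : List.In U (B p.1).
    elim: (B p.1) p.2 BU => [|V' r IH] [|i] //= => [[->]|/IH]; by [left|right].
  exact.
exists (fun n => e (odflt (0, 0) (unpickle n))) => a _.
have [n [i [U BU Ua]]] := covered a.
by exists (pickle (n, i)); rewrite pickleK; apply: (eP (n, i) U a).
Qed.

(** * The two spaces under CH *)

Theorem theorem3p3 :
  CH ->
  exists (X : Type) (oX : (X -> Prop) -> Prop) (Y : Type) (oY : (Y -> Prop) -> Prop),
    space oX /\ space oY /\
    (forall I : Type, inhabited I ->
       weakly_Rothberger (power_open I oX) /\ weakly_Rothberger (power_open I oY)) /\
    ~ weakly_Menger (prod_open oX oY).
Proof.
move=> /CH_well_order[lt [wf tr tri seg]].
pose T := nat -> bool.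
have inhT : inhabited T by exact: (inhabits xpred0).
(* Coding [M] by its graph makes every function the value of [E] at some point of [T]. *)
pose graph (M : seq nat -> nat) : T :=
  fun n => if unpickle n is Some (s, v) then M s == v else false.
have graph_inj : injective graph.
  move=> M M' /(congr1 (@^~ _)) MM'; apply/funext => s.
  by have := MM' (pickle (s, M s)); rewrite /graph pickleK eqxx => /esym/eqP.
have /choice[E E_spec] (a : T) : exists M, forall M', graph M' = a -> M = M'.
  have [[M Ma]|no_M] := pselect (exists M, graph M = a).
    by exists M => M'; rewrite -Ma => /graph_inj.
  by exists (fun=> 0) => M Ma; case: no_M; exists M.
have E_onto M : exists a, E a = M by exists (graph M); apply: E_spec.
have [h [h_unb up low]] := catching_family wf tr seg E_onto.
pose Q a := upper_rel (h a); pose Q' a := lower_rel (h a).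
have Qanti : antitone_rel Q by move=> a m N N'; apply: leq_trans.
have Q'anti : antitone_rel Q'.
  by move=> a k N N' NN' Qa n nN; apply: Qa; apply: leq_trans NN'.
exists (nat + T)%type, (nbhd_open Q), (nat + T)%type, (nbhd_open Q').
split; [|split; [|split]].
- apply: nbhd_space => // a m; exists (h a m).+1.
  by rewrite /Q /upper_rel ltnn.
- apply: nbhd_space => // a k; have [m km] := h_unb a k; exists m.+1.
  by move=> /(_ m (ltnSn m)); rewrite leqNgt km.
- by move=> I inhI; split; apply: (power_weakly_Rothberger (lt := lt)).
- apply: product_not_weakly_Menger => // [|m k]; first exact: not_enumerable_cantor.
  exists k.+1, m.+1 => a Qa /(_ m (ltnSn m)).
  by rewrite leqNgt => /negP; apply.
Qed.
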